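(* Let $d\geq 3$ and let $q\equiv 1\pmod d$ be an odd prime power which is a perfect square. If $A\subset\mathbb{F}_q$ satisfies $A\hat{+}A\subset S_d\cup\{0\}$, then $|A|\leq\sqrt{q}$. Moreover, equality $|A|=\sqrt q$ holds if and only if $d\mid(\sqrt{q}+1)$ and $A=\alpha\,\mathbb{F}_{\sqrt{q}}$ for some $\alpha\in S_d$.
   Context: $S_d=\{x^d: x\in\mathbb{F}_q^*\}$, the subgroup of $\mathbb{F}_q^*$ of order $\frac{q-1}{d}$. For $A\subset\mathbb{F}_q$, $A\hat{+}A=\{a+b: a,b\in A,\ a\neq b\}$. $\mathbb{F}_{\sqrt q}$ denotes the unique subfield of $\mathbb{F}_q$ with $\sqrt q$ elements, and $\alpha\mathbb{F}_{\sqrt q}=\{\alpha x: x\in\mathbb{F}_{\sqrt q}\}$. *)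

(* Defs.v *)
From mathcomp Require Export all_boot all_order all_algebra all_field.

Set Implicit Arguments.
Unset Strict Implicit.
Unset Printing Implicit Defensive.

Import GRing.Theory.
Local Open Scope ring_scope.

Definition powers (F : finFieldType) (d : nat) : {set F} :=
  [set x ^+ d | x : F & x != 0].

Definition restricted_sumset (F : finFieldType) (A : {set F}) : {set F} :=
  [set a + b | a in A, b in A & a != b].

(* A finite field has at most one subfield of each cardinality, so this
   predicate determines K. Since 0^-1 = 0, [divring_closed] is closure under
   1, subtraction and division, i.e. K is a subfield. *)
Definition is_subfield_of_card (F : finFieldType) (n : nat) (K : {set F}) :=
  divring_closed K /\ #|K| = n.

Definition dilate (F : finFieldType) (alpha : F) (K : {set F}) : {set F} :=
  [set alpha * x | x in K].

(* Main.v *)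
Require Import Defs.
From mathcomp Require Import all_boot all_order all_algebra all_field.
From mathcomp Require Import all_fingroup all_solvable.
From mathcomp Require Import zify ring.

(* Write n = sqrt q, and let c_a be the Lagrange weights of a set A of n elements,
   so that sum_a c_a Q(a) is the coefficient of X^(n-1) in Q when deg Q < n.
   Replacing d by gcd(d, n + 1) or gcd(d, n - 1) one may assume that d >= 3
   divides n + 1 or n - 1; put m = (q - 1) / d, so that (a + b)^(m+1) = a + b for
   distinct a, b in A.

   Stepanov's method applied to R = sum_a c_a (a - x)^M (a + x)^(m+j) shows that R
   vanishes to order min(M, j) at every point of A (up to a constant), hence is
   constant as soon as n min(M, j) exceeds its degree.  If d | n - 1, a suitable
   (M, j) contradicts the value of its leading coefficient.

   If n + 1 = d e, then (a + x)^(en) = (a^n + x^n)^e, and separating the powers of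
   x^n shows that each a |-> a^(nt) with p not dividing C(e, t) is interpolated on
   A by a polynomial of degree at most e.  In particular
   g = prod_a (x - a) = x^n - phi(x) with deg phi < e.  With
   h = prod_a (x + a) = x^n + phi(-x) and P = sum_a c_a (x + a)^(en-1), the same
   method gives P = const g^(e-1), while h P = Y(x, x^n) for some Y(x, T) of degree
   at most e in x with Y(x, 0) = (-x)^e.  The logarithmic derivative of
   h g^(e-1) then makes T + phi(-x) a factor of Y(x, T), so phi(-x) divides x^e;
   as g is separable, phi = c x, that is a^n = c a on A. *)

Set Implicit Arguments.
Unset Strict Implicit.
Unset Printing Implicit Defensive.

Import GRing.Theory.
Local Open Scope ring_scope.

(** * Coefficients, sizes and root multiplicities of polynomials *)

Lemma coef_XaddCn (R : comNzRingType) (v : R) (K l : nat) :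
  (('X + v%:P) ^+ K)`_l = v ^+ (K - l) * 'C(K, l)%:R.
Proof.
rewrite mulr_natr.
have -> : ('X + v%:P) ^+ K = \poly_(i < K.+1) (v ^+ (K - i) *+ 'C(K, i)).
  rewrite poly_def addrC exprDn; apply: eq_bigr => i _.
  by rewrite -polyC_exp -mul_polyC -mulrnAl polyCMn.
rewrite coef_poly ltnS; case: leqP => // lKl.
by rewrite bin_small.
Qed.

Section PolyAux.

Variable F : fieldType.

Lemma coef_CsubXn (v : F) (K l : nat) :
  ((v%:P - 'X) ^+ K)`_l = (-1) ^+ l * v ^+ (K - l) * 'C(K, l)%:R.
Proof.
rewrite mulr_natr.
have -> : (v%:P - 'X) ^+ K =
    \poly_(i < K.+1) ((-1) ^+ i * v ^+ (K - i) *+ 'C(K, i)).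
  rewrite poly_def exprDn; apply: eq_bigr => i _.
  rewrite (exprNn 'X) -mul_polyC polyCMn polyCM !polyC_exp polyCN mulrnAl.
  by congr (_ *+ _); rewrite mulrCA mulrA.
rewrite coef_poly ltnS; case: leqP => // lKl.
by rewrite bin_small.
Qed.

Lemma size_exp_XaddC (v : F) (K : nat) : size (('X + v%:P) ^+ K) = K.+1.
Proof. by rewrite -[v]opprK polyCN size_exp_XsubC. Qed.

Lemma size_exp_CsubX (v : F) (K : nat) : size ((v%:P - 'X) ^+ K) = K.+1.
Proof.
by rewrite -opprB exprNn -signr_odd mulr_sign; case: odd;
   rewrite ?size_polyN size_exp_XsubC.
Qed.

Lemma dvdp_exp_XsubC_coef (p : {poly F}) (b : F) (mu : nat) :
  (forall i, (i < mu)%N -> (p \Po ('X + b%:P))`_i = 0) ->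
  ('X - b%:P) ^+ mu %| p.
Proof.
move=> h; rewrite -[p](comp_polyXaddC_K _ b).
rewrite -[p \Po ('X + _)](poly_take_drop mu).
have -> : take_poly mu (p \Po ('X + b%:P)) = 0.
  by apply/polyP=> i; rewrite coef_take_poly coef0; case: ifP => // /h.
by rewrite add0r comp_polyM rmorphXn /= comp_polyX dvdp_mull.
Qed.

Lemma dvdp_prod_exp_XsubC (p : {poly F}) (s : seq F) (mu : nat) :
  uniq s -> (forall b, b \in s -> ('X - b%:P) ^+ mu %| p) ->
  (\prod_(b <- s) ('X - b%:P)) ^+ mu %| p.
Proof.
elim: s => [|b s IH] /=; first by rewrite big_nil expr1n dvd1p.
case/andP=> bs us h; rewrite big_cons exprMn Gauss_dvdp.
  rewrite h ?mem_head //= IH // => c cs.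
  by rewrite h // inE cs orbT.
apply: coprimep_expl; apply: coprimep_expr.
by rewrite coprimep_sym coprimep_XsubC root_prod_XsubC.
Qed.

Lemma comp_polyNXK (p : {poly F}) : (p \Po (- 'X)) \Po (- 'X) = p.
Proof. by rewrite -comp_polyA rmorphN /= comp_polyX opprK comp_polyXr. Qed.

Lemma size_comp_polyNX (p : {poly F}) : size (p \Po (- 'X)) = size p.
Proof. by rewrite size_comp_poly2 // size_polyN size_polyX. Qed.

End PolyAux.

(** * Lagrange weights and the Stepanov polynomial *)

Section Weights.

Variables (F : finFieldType) (A : {set F}).

Definition set_poly : {poly F} := \prod_(a in A) ('X - a%:P).
Definition lagrange_weight (a : F) : F := (\prod_(b in A :\ a) (a - b))^-1.
Definition lagrange_poly (a : F) : {poly F} :=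
  lagrange_weight a *: \prod_(b in A :\ a) ('X - b%:P).
Definition interpolant (v : F -> F) : {poly F} :=
  \sum_(a in A) v a *: lagrange_poly a.

Lemma set_poly_enum : set_poly = \prod_(a <- enum A) ('X - a%:P).
Proof. by rewrite /set_poly big_enum. Qed.

Lemma size_set_poly : size set_poly = #|A|.+1.
Proof. by rewrite set_poly_enum size_prod_XsubC -cardE. Qed.

Lemma monic_set_poly : set_poly \is monic.
Proof. exact: monic_prod_XsubC. Qed.

Lemma root_set_poly a : root set_poly a = (a \in A).
Proof. by rewrite set_poly_enum root_prod_XsubC mem_enum. Qed.

Lemma set_poly_split a : a \in A ->
  set_poly = ('X - a%:P) * \prod_(b in A :\ a) ('X - b%:P).
Proof.
move=> aA; rewrite /set_poly (bigD1 a) //=; congr (_ * _).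
by apply: eq_bigl => b; rewrite !inE andbC.
Qed.

Lemma lagrange_weight_neq0 a : lagrange_weight a != 0.
Proof.
rewrite invr_eq0; apply/prodf_neq0 => b; rewrite !inE => /andP[ab _].
by rewrite subr_eq0 eq_sym.
Qed.

Lemma deriv_set_poly_neq0 a : a \in A -> set_poly^`().[a] != 0.
Proof.
move=> aA; rewrite (set_poly_split aA) derivM !hornerE derivXsubC !hornerE.
rewrite subrr mul0r addr0 horner_prod.
under eq_bigr do rewrite hornerXsubC.
by rewrite -invr_eq0; exact: lagrange_weight_neq0.
Qed.

Lemma size_lagrange_poly a : a \in A -> (size (lagrange_poly a) <= #|A|)%N.
Proof.
move=> aA; apply: leq_trans (size_scale_leq _ _) _.
rewrite -big_enum size_prod_XsubC -cardE (cardsD1 a A) aA.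
by [].
Qed.

Lemma coef_lagrange_poly a : a \in A ->
  (lagrange_poly a)`_#|A|.-1 = lagrange_weight a.
Proof.
move=> aA; rewrite coefZ (cardsD1 a A) aA /=.
have := lead_coef_prod_XsubC (enum (A :\ a)) xpredT id.
rewrite lead_coefE size_prod_XsubC -cardE /= big_enum => ->.
by rewrite mulr1.
Qed.

Lemma lagrange_polyE a b : a \in A -> b \in A ->
  (lagrange_poly a).[b] = (a == b)%:R.
Proof.
move=> aA bA; rewrite hornerZ horner_prod.
under eq_bigr do rewrite hornerXsubC.
case: eqVneq => [<-|ab].
  by rewrite mulVf //; rewrite -invr_eq0 lagrange_weight_neq0.
by rewrite (bigD1 b) ?inE ?bA 1?eq_sym ?ab //= subrr mul0r mulr0.
Qed.

Lemma size_interpolant v : (size (interpolant v) <= #|A|)%N.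
Proof.
apply: leq_trans (size_sum _ _ _) _; apply/bigmax_leqP => a aA.
by apply: leq_trans (size_scale_leq _ _) _; apply: size_lagrange_poly.
Qed.

Lemma horner_interpolant v b : b \in A -> (interpolant v).[b] = v b.
Proof.
move=> bA; rewrite horner_sum (bigD1 b) //= hornerZ lagrange_polyE // eqxx.
rewrite mulr1 big1 ?addr0 // => a /andP[aA ab].
by rewrite hornerZ lagrange_polyE // (negbTE ab) mulr0.
Qed.

Lemma poly_eq_on (p q : {poly F}) :
  (size p <= #|A|)%N -> (size q <= #|A|)%N ->
  (forall a, a \in A -> p.[a] = q.[a]) -> p = q.
Proof.
move=> sp sq h; apply/eqP; rewrite -subr_eq0; apply/negP => /negP nz.
have := @max_poly_roots _ (p - q) (enum A) nz.
rewrite enum_uniq -cardE => /(_ _ isT) H.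
have /H : all (root (p - q)) (enum A).
  apply/allP => a; rewrite mem_enum => /h e.
  by rewrite rootE !hornerE e subrr.
apply/negP; rewrite -leqNgt; apply: leq_trans (size_polyD _ _) _.
by rewrite size_polyN geq_max sp.
Qed.

Lemma interpolant_horner (p : {poly F}) :
  (size p <= #|A|)%N -> interpolant (horner p) = p.
Proof.
move=> sp; apply: poly_eq_on (size_interpolant _) sp _ => a.
exact: horner_interpolant.
Qed.

Lemma sum_weight_interpolant v :
  \sum_(a in A) lagrange_weight a * v a = (interpolant v)`_#|A|.-1.
Proof.
rewrite coef_sum; apply: eq_bigr => a aA.
by rewrite coefZ coef_lagrange_poly // mulrC.
Qed.

Lemma sum_weight (p : {poly F}) : (size p <= #|A|)%N ->
  \sum_(a in A) lagrange_weight a * p.[a] = p`_#|A|.-1.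
Proof. by move=> sp; rewrite sum_weight_interpolant interpolant_horner. Qed.

Lemma sum_weight_exp s : (s < #|A|)%N ->
  \sum_(a in A) lagrange_weight a * a ^+ s = (s.+1 == #|A|)%:R.
Proof.
move=> ltsA.
under eq_bigr do rewrite -hornerXn.
rewrite sum_weight ?size_polyXn // coefXn.
by congr (_%:R); congr nat_of_bool; apply/eqP/eqP; lia.
Qed.

(** Induction on [N]: once the interpolant has degree below n - N, its product with X^N has degree
    below n, so the moment of order N is exactly its coefficient of degree n - 1 - N. *)
Lemma size_interpolant_moments v N : (N <= #|A|)%N ->
  (forall s, (s < N)%N -> \sum_(a in A) lagrange_weight a * (v a * a ^+ s) = 0) ->
  (size (interpolant v) <= #|A| - N)%N.
Proof.
elim: N => [|N IH] ltNA h; first by rewrite subn0 size_interpolant.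
have {}IH : (size (interpolant v) <= #|A| - N)%N.
  by apply: IH => [|s lsN]; [lia | apply: h; lia].
have := h N (leqnn _).
have -> : \sum_(a in A) lagrange_weight a * (v a * a ^+ N)
    = \sum_(a in A) lagrange_weight a * (interpolant v * 'X^N).[a].
  by apply: eq_bigr => a aA; rewrite hornerM hornerXn horner_interpolant.
rewrite sum_weight; last first.
  apply: leq_trans (size_polyMleq _ _) _; rewrite size_polyXn; lia.
rewrite coefMXn ifF; last by apply/negbTE; lia.
move=> c0; apply/leq_sizeP => j lej.
have [/eqP ej|nej] := boolP (j == #|A|.-1 - N)%N; first by rewrite ej.
by move/leq_sizeP: IH; apply; lia.
Qed.

(** This is R of the overview when [K] is m + j, and P when [M] is 0 and [K] is n e - 1. *)
Definition sum_poly (M K : nat) : {poly F} :=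
  \sum_(a in A) lagrange_weight a *: ((a%:P - 'X) ^+ M * ('X + a%:P) ^+ K).

(** (a - X)^M (X + a)^K is homogeneous in a and X, so each of its coefficients is the one at a = 1
    times a power of a. *)
Lemma coef_sum_poly M K I : (I <= M + K)%N ->
  (sum_poly M K)`_I = ((1%:P - 'X) ^+ M * ('X + 1%:P) ^+ K : {poly F})`_I *
    \sum_(a in A) lagrange_weight a * a ^+ (M + K - I).
Proof.
move=> leI; rewrite coef_sum mulr_sumr; apply: eq_bigr => a aA.
rewrite coefZ mulrCA; congr (_ * _).
rewrite !coefM mulr_suml; apply: eq_bigr => k _.
rewrite !coef_CsubXn !coef_XaddCn !expr1n mulr1.
(* Outside these ranges truncated subtraction breaks homogeneity, but then a binomial coefficient is
   0. *)
have [lkM|lMk] := leqP k M; last by rewrite bin_small // !mulr0 !mul0r.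
have [lkK|lKk] := leqP (I - k) K; last first.
  by rewrite ['C(K, _)]bin_small // !mulr0 mul0r.
have -> : (M + K - I = (M - k) + (K - (I - k)))%N.
  by case: k lkM lkK => k /= ? ? ?; lia.
rewrite exprD; ring.
Qed.

(** The coefficient of X^I carries the weighted sum of a^(M + K - I), which is 0 for exponents below
    n - 1. *)
Lemma size_sum_poly M K : (size (sum_poly M K) <= (M + K - #|A|.-1).+1)%N.
Proof.
have [eA|A0] := eqVneq A set0.
  by rewrite /sum_poly big1 ?size_poly0 // => a; rewrite eA inE.
have {}A0 : (0 < #|A|)%N by rewrite card_gt0.
apply/leq_sizeP => I lI; have [leI|ltI] := leqP I (M + K).
  rewrite coef_sum_poly // sum_weight_exp; last by lia.
  by case: eqP => [?|_]; [lia | rewrite mulr0].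
rewrite coef_sum big1 // => a _; rewrite coefZ nth_default ?mulr0 //.
apply: leq_trans (size_polyMleq _ _) _.
rewrite size_exp_CsubX size_exp_XaddC; lia.
Qed.

(* The M-fold zero of (a - x)^M at x = a hides the diagonal sums b + b, about
   which nothing is known. *)
Lemma dvdp_sum_poly m mu M j b :
  b \in A -> (mu <= j)%N -> (M + j < #|A|)%N ->
  (forall a, a \in A -> a != b -> (a + b) ^+ m.+1 = a + b) ->
  (mu <= M)%N \/ (b + b) ^+ m.+1 = b + b ->
  ('X - b%:P) ^+ mu %| sum_poly M (m + j) - ((M + j).+1 == #|A|)%:R%:P.
Proof.
move=> bA muj MjA hb hd; apply: dvdp_exp_XsubC_coef => i ltimu.
have shift a K : (a + b) ^+ m.+1 = a + b -> (0 < K)%N ->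
    (a + b) ^+ (m + K) = (a + b) ^+ K.
  by move=> e; case: K => // K _; rewrite addnS -addSn exprD e -exprS.
(* The Taylor coefficient of order i at b is a combination of these sums. Dropping m from the
   exponent leaves a monic polynomial in a of degree M + j - i < n, whose weighted sum is 1 if that
   degree is n - 1 and 0 otherwise. *)
have cross k : (k <= i)%N -> (k <= M)%N ->
    \sum_(a in A) lagrange_weight a *
      ((a - b) ^+ (M - k) * (a + b) ^+ (m + j - (i - k)))
    = ((i == 0) && ((M + j).+1 == #|A|))%:R.
  move=> lki lkM.
  pose Q : {poly F} := ('X - b%:P) ^+ (M - k) * ('X - (- b)%:P) ^+ (j - (i - k)).
  have mQ : Q \is monic by rewrite monicMr ?monic_exp ?monicXsubC.
  have sQ : size Q = (M + j - i).+1.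
    rewrite size_monicM ?monic_neq0 ?monic_exp ?monicXsubC // !size_exp_XsubC.
    by lia.
  transitivity (\sum_(a in A) lagrange_weight a * Q.[a]).
    apply: eq_bigr => a aA; congr (_ * _).
    rewrite hornerM !horner_exp !hornerXsubC opprK.
    have -> : (m + j - (i - k) = m + (j - (i - k)))%N by lia.
    have [->|nab] := eqVneq a b; last by rewrite shift ?hb //; lia.
    case: hd => [lemuM|hd]; last by rewrite shift //; lia.
    case E: (M - k)%N => [|t]; first by lia.
    by rewrite subrr exprS !mul0r.
  rewrite sum_weight ?sQ; last by lia.
  have [/andP[/eqP i0 /eqP eA]|nb] := boolP ((i == 0)%N && _).
    by move/monicP: mQ; rewrite lead_coefE sQ /= -eA i0 subn0.
  by rewrite nth_default // sQ; lia.
rewrite comp_polyB comp_polyC coefB coefC /sum_poly raddf_sum coef_sum /=.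
under eq_bigr => a aA.
  rewrite comp_polyZ comp_polyM !rmorphXn /= comp_polyB comp_polyD.
  rewrite !comp_polyX !comp_polyC.
  have -> : a%:P - ('X + b%:P) = (a - b)%:P - 'X by rewrite polyCB; ring.
  have -> : 'X + b%:P + a%:P = 'X + (a + b)%:P by rewrite polyCD; ring.
  rewrite coefZ coefM mulr_sumr.
  over.
rewrite exchange_big /=; apply/eqP; rewrite subr_eq0; apply/eqP.
transitivity (\sum_(k < i.+1) (-1) ^+ k * 'C(M, k)%:R * 'C(m + j, i - k)%:R *
    ((i == 0) && ((M + j).+1 == #|A|))%:R : F).
  apply: eq_bigr => k _.
  have [lekM|ltMk] := leqP k M; last first.
    rewrite (bin_small ltMk) mulr0 !mul0r big1 // => a _.
    by rewrite coef_CsubXn (bin_small ltMk) mulr0 mul0r mulr0.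
  rewrite -(cross k) //; last by rewrite -ltnS.
  rewrite mulr_sumr; apply: eq_bigr => a _.
  rewrite coef_CsubXn coef_XaddCn; ring.
case: i {cross ltimu} => [|i] /=; last by rewrite big1 // => k _; rewrite mulr0.
by rewrite big_ord1 !bin0 !mul1r.
Qed.

End Weights.

(** * Fixed restricted sums and constancy of the Stepanov polynomial *)

(** The form x^(m+1) = x, rather than x^m = 1, admits the sum 0. *)
Definition restricted_sums_fixed (F : finFieldType) (A : {set F}) (m : nat) :=
  forall a b, a \in A -> b \in A -> a != b -> (a + b) ^+ m.+1 = a + b.

Section PcharPower.

Variables (F : fieldType) (n : nat).
Hypotheses (pn : [pchar F].-nat n) (n_gt1 : (1 < n)%N).

Lemma natr_pcharnat : n%:R = 0 :> F.
Proof.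
have pF : pdiv n \in [pchar F].
  by apply: (pnatPpi pn); rewrite pi_pdiv.
by case/dvdnP: (pdiv_dvd n) => c ->; rewrite natrM (pcharf0 pF) mulr0.
Qed.

Lemma two_neq0 : odd n -> 2%:R != 0 :> F.
Proof.
move=> on; apply/eqP => z2; move: natr_pcharnat.
rewrite -(odd_double_half n) on -muln2 natrD natrM z2 mulr0 addr0.
by move/eqP; rewrite oner_eq0.
Qed.

Lemma pcharnat_poly : [pchar {poly F}].-nat n.
Proof. by rewrite (eq_pnat _ (@pchar_poly F)). Qed.

Lemma exprD_pcharnat (x y : F) t : (x + y) ^+ (n * t) = (x ^+ n + y ^+ n) ^+ t.
Proof. by rewrite exprM exprDn_pchar. Qed.

Lemma exprD_pcharnat_poly (x y : {poly F}) t :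
  (x + y) ^+ (n * t) = (x ^+ n + y ^+ n) ^+ t.
Proof. by rewrite exprM exprDn_pchar ?pcharnat_poly. Qed.

End PcharPower.

Section Vanishing.

Variables (F : finFieldType) (A : {set F}) (m : nat).
Hypothesis hA : restricted_sums_fixed A m.

(** The difference vanishes to order [mu] at all n points of [A], while its degree is below mu n. *)
Lemma sum_poly_const mu M j :
  (mu <= M)%N -> (mu <= j)%N -> (M + j < #|A|)%N ->
  (M + (m + j) - #|A|.-1 < mu * #|A|)%N ->
  sum_poly A M (m + j) = ((M + j).+1 == #|A|)%:R%:P.
Proof.
move=> muM muj MjA hdeg; apply/eqP; rewrite -subr_eq0; apply: contraTT hdeg.
set p := _ - _ => p0; rewrite -leqNgt.
have : set_poly A ^+ mu %| p.
  rewrite set_poly_enum; apply: dvdp_prod_exp_XsubC (enum_uniq _) _ => b.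
  rewrite mem_enum => bA; apply: dvdp_sum_poly => //; last by left.
  by move=> a aA ab; apply: hA.
move/(dvdp_leq p0); have := size_exp (set_poly A) mu.
rewrite size_set_poly /=.
have : (size p <= (M + (m + j) - #|A|.-1).+1)%N.
  apply: leq_trans (size_polyD _ _) _; rewrite size_polyN geq_max.
  by rewrite size_sum_poly (leq_trans (size_polyC_leq1 _)).
move=> h1 h2 h3; rewrite mulnC -h2 -subn1 leq_subLR add1n.
exact: leq_trans h3 h1.
Qed.

End Vanishing.

(** * The case d k = n - 1 *)

(** (X + 1)^(n k) = (X^n + 1)^k, and only its top term X^(n k) contributes: the others would need a
    term of degree above M + l in the remaining factor. *)
Lemma coef_CsubX_XaddC_block (F : fieldType) (n k M l : nat) :
  [pchar F].-nat n -> (n.-1 <= M + l)%N -> (0 < n)%N ->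
  ((1%:P - 'X) ^+ M * ('X + 1%:P) ^+ (n * k + l) : {poly F})`_(n * k + (M + l - n.-1))
  = ((1%:P - 'X) ^+ M * ('X + 1%:P) ^+ l : {poly F})`_(M + l - n.-1).
Proof.
move=> pn leM n0; set W : {poly F} := (1%:P - 'X) ^+ M * ('X + 1%:P) ^+ l.
have sW : (size W <= (M + l).+1)%N.
  by apply: leq_trans (size_polyMleq _ _) _; rewrite size_exp_CsubX size_exp_XaddC; lia.
have -> : (1%:P - 'X) ^+ M * ('X + 1%:P) ^+ (n * k + l) = W * ('X^n + 1) ^+ k.
  by rewrite exprD exprD_pcharnat_poly // -polyC_exp expr1n mulrCA mulrC.
rewrite exprDn mulr_sumr coef_sum big_ord_recl /= subn0 bin0 mulr1 -exprM.
rewrite coefMXn ltnNge leq_addr /= addKn big1 ?addr0 // => t _.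
rewrite expr1n mulr1 -exprM mulrnAr coefMn coefMXn.
case: ifP => [_|]; first by rewrite mul0rn.
move=> h; rewrite nth_default ?mul0rn //; apply: leq_trans sW _.
case: t h => t /= tk; rewrite /bump /= add1n; nia.
Qed.

(** With M = k + 1 and m = k (n + 1), R is constant. Its coefficient of degree M + m + j - (n - 1)
    carries the weighted sum of a^(n-1), which is 1, so the numerical factor must be 0 in [F]; the
    proof finds j for which it is not. *)
Lemma dvd_pred_no_restricted_sums (F : finFieldType) (A : {set F}) (d k : nat) :
  [pchar F].-nat #|A| -> odd #|A| -> (3 <= d)%N -> (0 < k)%N ->
  (d * k).+1 = #|A| -> ~ restricted_sums_fixed A (k * #|A|.+1).
Proof.
move=> pA oA d3 k0 dk hA.
have A1 : (1 < #|A|)%N by nia.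
suff [j [lkj ljA nz hi]] : exists j, [/\ (k < j)%N, (k + j + 1 < #|A|)%N,
    ((1%:P - 'X) ^+ k.+1 * ('X + 1%:P) ^+ (k + j) : {poly F})`_(k.+1 + (k + j) - #|A|.-1) != 0
    & (#|A|.-1 <= k.+1 + (k + j) <= #|A|.+1)%N].
  have [] := andP hi => hi1 hi2.
  have eK : (k * #|A|.+1 + j = #|A| * k + (k + j))%N by nia.
  have := @sum_poly_const F A (k * #|A|.+1) hA k.+1 k.+1 j.
  move=> /(_ (leqnn _) lkj) H.
  have {}H := H ltac:(lia) ltac:(nia).
  have := congr1 (fun p : {poly F} => p`_(k.+1 + (k * #|A|.+1 + j) - #|A|.-1)) H.
  rewrite coefC ifF; last by apply/negbTE; nia.
  rewrite coef_sum_poly; last by lia.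
  rewrite subKn; last by nia.
  rewrite sum_weight_exp; last by lia.
  rewrite prednK; last by lia.
  rewrite eqxx mulr1 eK.
  have -> : (k.+1 + (#|A| * k + (k + j)) - #|A|.-1 =
             #|A| * k + (k.+1 + (k + j) - #|A|.-1))%N by lia.
  rewrite coef_CsubX_XaddC_block //; last by lia.
  by apply/eqP.
(* For j = (d - 2) k - 1 the reduced index is 0 and the coefficient is 1; the condition k < j then
   reads (d - 3) k >= 2. *)
have [hbig|hsmall] := leqP 2 ((d - 3) * k).
  exists ((d - 2) * k - 1)%N; split; [nia|nia| |nia].
  have -> : (k.+1 + (k + ((d - 2) * k - 1)) - #|A|.-1 = 0)%N by nia.
  rewrite -horner_coef0 hornerM !horner_exp !hornerE ?subr0 !expr1n mulr1.
  exact: oner_neq0.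
have z2 := two_neq0 pA A1 oA.
have [d_3|d_n3] := eqVneq d 3.
  have k2 : (1 < k)%N by move: oA; rewrite -dk d_3; case: (k) k0 => [|[]].
  (* Now n = 3 k + 1 and the coefficient x, at index 2, satisfies 2 x = k^2 - 3 k - 2. Since 3 k =
     -1 in [F], this gives 18 x = -8, which is nonzero in odd characteristic. *)
  exists k.+1; split; [lia|nia| |nia].
  have -> : (k.+1 + (k + k.+1) - #|A|.-1 = 2)%N by nia.
  rewrite coefM !big_ord_recr big_ord0 /= !coef_CsubXn !coef_XaddCn !expr1n.
  rewrite !bin0 !bin1 !mulr1 add0r.
  have b2 t : 'C(t, 2)%:R * 2%:R = t%:R * (t%:R - 1) :> F.
    rewrite -natrM mulnC -mul_bin_diag bin1.
    by case: t => [|t]; rewrite ?mul0n ?mul0r // natrM /= -natr1 addrK.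
  have h3 : 3%:R * k%:R = -1 :> F.
    apply/eqP; rewrite -addr_eq0 -(natr_pcharnat pA A1) -dk d_3.
    by rewrite -[(3 * k).+1]addn1 natrD natrM.
  set x := (X in X != 0); apply/eqP => x0.
  have hx : x * 2%:R = k%:R ^+ 2 - 3%:R * k%:R - 2%:R.
    transitivity ('C(k + k.+1, 2)%:R * 2%:R + 'C(k.+1, 2)%:R * 2%:R
                  - 2%:R * k.+1%:R * (k + k.+1)%:R : F).
      by rewrite /x subn0; ring.
    by rewrite !b2; ring.
  have : 2%:R ^+ 3 = 0 :> F.
    have : 9%:R * (x * 2%:R) = 0 by rewrite x0 mul0r mulr0.
    rewrite hx => h.
    have -> : 2%:R ^+ 3 = (3%:R * k%:R) ^+ 2 - 9%:R * (3%:R * k%:R) - 10%:R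
        - 9%:R * (k%:R ^+ 2 - 3%:R * k%:R - 2%:R) :> F by ring.
    by rewrite h h3; ring.
  by move/eqP; rewrite expf_eq0 (negbTE z2).
(* Only n = 5 is left, where the coefficient of X in (1 - X)^2 (1 + X)^3 is 1. *)
have k1 : k = 1 by nia.
have d4 : d = 4 by nia.
have A5 : #|A| = 5 by lia.
exists 2; split; rewrite ?A5 k1 //.
rewrite coefM !big_ord_recr big_ord0 /= !coef_CsubXn !coef_XaddCn !expr1n.
rewrite [X in X != 0](_ : _ = 1) ?oner_neq0 //.
rewrite /= (_ : 'C(2, 0) = 1)%N // (_ : 'C(2, 1) = 2)%N //.
rewrite (_ : 'C(1 + 2, 1 - 0) = 3)%N // (_ : 'C(1 + 2, 1 - 1) = 1)%N //; ring.
Qed.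

(** * Polynomials in x^n and x *)

Section Bivariate.

Variable F : fieldType.
Implicit Type B C : {poly {poly F}}.

(** [B] is read as a polynomial in T over F[x]; this bounds its degree in x. *)
Definition coefs_size_le k B := forall u, (size (B`_u)%R <= k)%N.

Lemma coefs_size_leD k B C :
  coefs_size_le k B -> coefs_size_le k C -> coefs_size_le k (B + C).
Proof.
move=> hB hC u; rewrite coefD; apply: leq_trans (size_polyD _ _) _.
by rewrite geq_max hB hC.
Qed.

Lemma coefs_size_leN k B : coefs_size_le k B -> coefs_size_le k (- B).
Proof. by move=> hB u; rewrite coefN size_polyN. Qed.

Lemma coefs_size_leM k l B C :
  coefs_size_le k B -> coefs_size_le l C -> coefs_size_le (k + l).-1 (B * C).
Proof.
move=> hB hC u; rewrite coefM; apply: leq_trans (size_sum _ _ _) _.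
apply/bigmax_leqP => i _; apply: leq_trans (size_polyMleq _ _) _.
have := hB i; have := hC (u - i)%N; lia.
Qed.

Lemma coefs_size_leC k (p : {poly F}) :
  (size p <= k)%N -> coefs_size_le k p%:P.
Proof. by move=> hp u; rewrite coefC; case: ifP; rewrite ?size_poly0. Qed.

Lemma coefs_size_leX k : (0 < k)%N -> coefs_size_le k 'X.
Proof. by move=> k0 u; rewrite coefX; case: eqP; rewrite ?size_poly1 ?size_poly0. Qed.

Lemma coefs_size_leW k l B : (k <= l)%N -> coefs_size_le k B -> coefs_size_le l B.
Proof. by move=> kl hB u; apply: leq_trans (hB u) kl. Qed.

(** With degrees in x below n, the exponents n u + w with w < n determine u and w, so substituting
    x^n for T is injective. *)
Lemma horner_Xn_eq0 n B : coefs_size_le n B -> B.['X^n] = 0 -> B = 0.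
Proof.
move=> hB B0; apply/polyP => u; apply/polyP => w; rewrite coef0 coef0.
have [lenw|ltwn] := leqP n w; first by rewrite nth_default // (leq_trans (hB u)).
have := congr1 (fun p : {poly F} => p`_(n * u + w)) B0.
rewrite horner_coef coef_sum coef0.
have [ltu|leu] := ltnP u (size B); last by rewrite (nth_default 0 leu) coef0.
rewrite (bigD1 (Ordinal ltu)) //= -exprM coefMXn ltnNge leq_addr addKn /=.
rewrite big1 ?addr0 // => v nvu; rewrite -exprM coefMXn.
case: ltnP => // lev; rewrite nth_default //; apply: leq_trans (hB v) _.
have {}nvu : (v != u :> nat) by apply: contraNneq nvu => e; apply/eqP/val_inj.
by case: (v) nvu lev => v' _ /= ? ?; nia.
Qed.

Lemma deriv_horner_Xn n B : n%:R = 0 :> F ->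
  (B.['X^n])^`() = (map_poly (@deriv F) B).['X^n].
Proof.
move=> n0; rewrite horner_coef raddf_sum /=.
rewrite (@horner_coef_wide _ (size B)); last exact: size_poly.
apply: eq_bigr => u _; rewrite coef_map_id0 ?deriv0 // derivM -!exprM derivXn.
by rewrite -mulr_natr natrM -polyC1 -!polyCMn n0 mul0r !mulr0 addr0.
Qed.

Lemma dvdp_coef0 B (p : {poly F}) : B.[p] = 0 -> p %| B`_0.
Proof.
move=> B0; have := poly_take_drop 1 B => eB.
have := B0; rewrite -{1}eB hornerD hornerM hornerXn.
rewrite [take_poly _ _]size1_polyC ?size_take_poly // coef_take_poly hornerC.
by move/eqP; rewrite addr_eq0 => /eqP ->; rewrite dvdpNr dvdp_mull.
Qed.

End Bivariate.

(** * Moments recovered from products of linear forms *)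

(** Expanding a^s = ((X + a) - X)^s evaluates the sums of w(a) a^s (a - X)^e, whose coefficients of
    X^t are multiples of moments. Taking t = 0 and t = e reaches the orders at least e and at most N
    - e. As 2 e <= N + 2, only e - 1 = N - e + 1 can be missing, and t = e - 1 reaches it with
    factor e. *)
Lemma moments_of_products (F : finFieldType) (A : {set F}) (w : F -> F)
    (e N : nat) (c : F) :
  (1 < e <= N)%N -> (e.*2 <= N.+2)%N -> e%:R != 0 :> F ->
  (forall i, (i <= N - e)%N ->
    \sum_(a in A) w a *: ((a%:P - 'X) ^+ e * ('X + a%:P) ^+ i) =
    (c *+ (i == N - e)%N)%:P) ->
  forall s, (s <= N)%N -> \sum_(a in A) w a * a ^+ s = c *+ (s == N).
Proof.
move=> /andP[e1 eN] e2 e0 H.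
have {}H s : (s <= N - e)%N ->
    \sum_(a in A) (w a * a ^+ s) *: (a%:P - 'X) ^+ e = (c *+ (s == N - e)%N)%:P.
  move=> les.
  transitivity (\sum_(i < s.+1) ((- 'X) ^+ (s - i) * 'C(s, i)%:R) *
     \sum_(a in A) w a *: ((a%:P - 'X) ^+ e * ('X + a%:P) ^+ i)).
    rewrite (eq_bigr (fun i : 'I_s.+1 => \sum_(a in A)
       w a *: ((a%:P - 'X) ^+ e * ((- 'X) ^+ (s - i) * ('X + a%:P) ^+ i *+ 'C(s, i))))).
      rewrite exchange_big; apply: eq_bigr => a aA /=.
      rewrite -scaler_sumr -mulr_sumr -exprDn -scalerA addrA addNr add0r.
      by rewrite mulrC -polyC_exp mul_polyC.
    move=> i _; rewrite mulr_sumr; apply: eq_bigr => a _.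
    rewrite -scalerAr; congr (_ *: _); rewrite -[_ *+ 'C(s, i)]mulr_natr; ring.
  rewrite big_ord_recr /= subnn binn mulr1 mul1r H // big1 ?add0r // => i _.
  rewrite H; last by have := ltn_ord i; lia.
  by rewrite ltn_eqF ?mulr0n ?mulr0 //; have := ltn_ord i; lia.
have {}H s t : (s <= N - e)%N ->
    \sum_(a in A) w a * a ^+ s * a ^+ (e - t) * ((-1) ^+ t * 'C(e, t)%:R) =
    c *+ ((s == N - e)%N && (t == 0)).
  move=> les; have := congr1 (fun p : {poly F} => p`_t) (H s les).
  rewrite coefC coef_sum /= => h.
  transitivity (if t == 0 then c *+ (s == N - e)%N else 0); last first.
    by case: (t) => [|t'] /=; rewrite ?andbT ?andbF.
  rewrite -h; apply: eq_bigr => a _; rewrite coefZ coef_CsubXn; ring.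
move=> s leN; have [les|lts] := leqP e s.
  have := H (s - e)%N 0 ltac:(lia).
  rewrite andbT bin0 => h.
  transitivity (c *+ (s - e == N - e)%N); last first.
    by congr (_ *+ _); congr nat_of_bool; lia.
  rewrite -h; apply: eq_bigr => a _.
  by rewrite subn0 !mulr1 -mulrA -exprD subnK.
have sN : (s == N) = false by apply/negbTE; lia.
rewrite sN mulr0n.
have [les|ltes] := leqP s (N - e)%N.
  have := H s e les; rewrite (gtn_eqF (ltnW e1)) andbF mulr0n.
  rewrite -mulr_suml binn mulr1 subnn => /eqP; rewrite mulf_eq0 signr_eq0 orbF.
  by move/eqP; under eq_bigr do rewrite mulr1.
have := H (N - e)%N e.-1 (leqnn _).
rewrite [e.-1 == 0]gtn_eqF ?andbF ?mulr0n; last by lia.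
rewrite -mulr_suml => /eqP; rewrite !mulf_eq0 signr_eq0 /=.
have -> : 'C(e, e.-1) = e by rewrite -subn1 bin_sub ?bin1 //; lia.
rewrite (negbTE e0) orbF => /eqP h; rewrite -[RHS]h; apply: eq_bigr => a _.
by rewrite -mulrA -exprD; congr (_ * _ ^+ _); lia.
Qed.

(** * The case d e = n + 1 *)

Section DvdSucc.

Variables (F : finFieldType) (A : {set F}) (d e : nat).
Local Notation n := #|A|.
Local Notation m := (e * n.-1)%N.
Local Notation wt := (lagrange_weight A).
Hypotheses (pA : [pchar F].-nat n) (oA : odd n) (d3 : (3 <= d)%N).
Hypotheses (e2 : (2 <= e)%N) (de : (d * e)%N = n.+1).
Hypothesis hA : restricted_sums_fixed A m.

Let n_gt4 : (4 < n)%N. Proof. move: oA; nia. Qed.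
Let n_gt1 : (1 < n)%N. Proof. lia. Qed.
Let e3 : (3 * e <= n.+1)%N. Proof. nia. Qed.

Let e_neq0 : e%:R != 0 :> F.
Proof.
have h : d%:R * e%:R = 1 :> F.
  by rewrite -natrM de -addn1 natrD (natr_pcharnat pA n_gt1) add0r.
by apply: contraTneq (oner_neq0 F) => e0; rewrite -h e0 mulr0 negbK.
Qed.

Let two_neq0F : 2%:R != 0 :> F. Proof. exact: two_neq0 pA n_gt1 oA. Qed.

Lemma sum_poly_block M i : (e <= M)%N -> (M + i + e < n)%N ->
  sum_poly A M (n * e + i) = ((M + i + e).+1 == n)%:R%:P.
Proof.
move=> eM Mi; have -> : (n * e + i = m + (e + i))%N by nia.
rewrite (sum_poly_const hA eM); [|lia|lia|nia].
by rewrite addnA [(M + e + i)%N]addnAC.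
Qed.

(** The coefficient of T^u in (T + a^n)^e, which is (x + a)^(n e) with T in place of x^n. *)
Definition block_value (u : nat) (a : F) : F := a ^+ (n * (e - u)) * 'C(e, u)%:R.

(** The factors other than (X^n + a^n)^e have degree M + i < n, so [sum_poly_block] can be read off
    separately at each power of X^n. *)
Lemma sum_block M i u : (e <= M)%N -> (M + i + e < n)%N ->
  \sum_(a in A) (wt a * block_value u a) *: ((a%:P - 'X) ^+ M * ('X + a%:P) ^+ i)
  = (((M + i + e).+1 == n) && (u == 0))%:R%:P.
Proof.
move=> eM Mi.
pose B : {poly {poly F}} := \sum_(a in A)
  (wt a *: ((a%:P - 'X) ^+ M * ('X + a%:P) ^+ i))%:P * ('X + (a ^+ n)%:P%:P) ^+ e.
have BE v : B`_v = \sum_(a in A)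
    (wt a * block_value v a) *: ((a%:P - 'X) ^+ M * ('X + a%:P) ^+ i).
  rewrite coef_sum; apply: eq_bigr => a _; rewrite coefCM coef_XaddCn.
  rewrite -polyC_exp -exprM -polyC1 -polyCMn -polyCM mulrC mul_polyC scalerA.
  by rewrite mulrC.
suff {}BE0 : B - (((M + i + e).+1 == n)%:R%:P)%:P = 0.
  rewrite -BE; move/eqP: BE0; rewrite subr_eq0 => /eqP ->; rewrite coefC.
  by case: eqP => _; rewrite ?andbT ?andbF.
apply: (@horner_Xn_eq0 _ n).
  move=> v; rewrite coefB; apply: leq_trans (size_polyD _ _) _.
  rewrite size_polyN geq_max; apply/andP; split; last first.
    rewrite coefC; case: ifP; rewrite ?size_poly0 // => _.
    by apply: leq_trans (size_polyC_leq1 _) _; lia.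
  rewrite BE; apply: leq_trans (size_sum _ _ _) _; apply/bigmax_leqP => a _.
  apply: leq_trans (size_scale_leq _ _) _.
  apply: leq_trans (size_polyMleq _ _) _.
  by rewrite size_exp_CsubX size_exp_XaddC; lia.
rewrite hornerD hornerN hornerC -sum_poly_block // horner_sum.
apply/eqP; rewrite subr_eq0; apply/eqP; apply: eq_bigr => a _.
rewrite hornerM hornerC horner_exp hornerD hornerX hornerC.
rewrite exprD exprD_pcharnat_poly // polyC_exp -!mul_polyC; ring.
Qed.

(** [moments_of_products] with N = n - 1 - e; its condition 2 e <= N + 2 becomes 3 e <= n + 1, which
    follows from d >= 3. *)
Lemma block_moments u s : (s + e < n)%N ->
  \sum_(a in A) wt a * (block_value u a * a ^+ s) =
  (((s + e).+1 == n) && (u == 0))%:R.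
Proof.
move=> se.
have := @moments_of_products F A (fun a => wt a * block_value u a) e (n - 1 - e)
  (u == 0)%:R ltac:(lia) ltac:(lia) e_neq0.
move=> /(_ _ s ltac:(lia)) h.
under eq_bigr do rewrite mulrA.
rewrite h.
  have -> : (s == n - 1 - e)%N = ((s + e).+1 == n) by lia.
  by case: (_ == n); rewrite ?mulr1n ?mulr0n.
move=> i ile; rewrite sum_block; [|lia|lia].
have -> : ((e + i + e).+1 == n) = (i == n - 1 - e - e)%N by lia.
by case: (i == _); rewrite ?mulr1n ?mulr0n.
Qed.

Lemma size_block_interpolant u : (size (interpolant A (block_value u)) <= e.+1)%N.
Proof.
have := @size_interpolant_moments F A (block_value u) (n - e.+1).
rewrite subKn; last by lia.
apply; first by lia.
move=> s ls; rewrite block_moments; last by lia.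
by rewrite ltn_eqF //; lia.
Qed.

(** For a positive index the moment of order n - 1 - e vanishes too, which gains one degree. *)
Lemma size_block_interpolantS u : (size (interpolant A (block_value u.+1)) <= e)%N.
Proof.
have := @size_interpolant_moments F A (block_value u.+1) (n - e).
rewrite subKn; last by lia.
apply; first by lia.
by move=> s ls; rewrite block_moments ?andbF //; lia.
Qed.

Definition frob_poly : {poly F} := interpolant A (fun a => a ^+ n).
Local Notation phi := frob_poly.

(** The block value at u = e - 1 is e a^n, with e nonzero in [F]. This u is positive, so the sharper
    bound applies. *)
Lemma size_frob_poly : (size phi <= e)%N.
Proof.
have e1 : e.-1 = e.-2.+1 by lia.
have := size_block_interpolantS e.-2; rewrite -e1.
have -> : interpolant A (block_value e.-1) = e%:R *: phi.
  rewrite scaler_sumr; apply: eq_bigr => a _; rewrite [RHS]scalerA.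
  congr (_ *: lagrange_poly A a).
  rewrite /block_value; have -> : 'C(e, e.-1) = e by rewrite -subn1 bin_sub ?bin1 //; lia.
  have -> : (e - e.-1 = 1)%N by lia.
  by rewrite muln1 mulrC.
by rewrite size_scale.
Qed.

Lemma set_polyE : set_poly A = 'X^n - phi.
Proof.
suff <- : 'X^n - set_poly A = phi by rewrite subKr.
apply: (@poly_eq_on F A).
- apply/leq_sizeP => j; rewrite leq_eqVlt => /orP[/eqP <-|ltj].
    rewrite coefB coefXn eqxx; have/monicP := monic_set_poly A.
    by rewrite lead_coefE size_set_poly /= => ->; rewrite subrr.
  rewrite coefB coefXn gtn_eqF // nth_default ?subrr //.
  by rewrite size_set_poly.
- exact: size_interpolant.
move=> a aA; rewrite hornerD hornerN hornerXn horner_interpolant //.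
have : root (set_poly A) a by rewrite root_set_poly.
by move/rootP=> ->; rewrite subr0.
Qed.

Let shift b c j : b \in A -> c \in A -> c != b -> (0 < j)%N ->
  (c + b) ^+ (m + j) = (c + b) ^+ j.
Proof.
move=> bA cA cb; case: j => // j _.
by rewrite addnS -addSn exprD hA // -exprS.
Qed.

Let exponentE : (n * e - 1 = m + (e - 1))%N. Proof. nia. Qed.

(** Since (a + b) - (a - b) = 2 b, it suffices to insert the factor a + b or a - b. The first sum
    combines block moments of order 0; in the second the diagonal term vanishes and m drops from the
    exponent. *)
Lemma sum_poly0_root b : b \in A -> b != 0 ->
  \sum_(a in A) wt a * (a + b) ^+ (n * e - 1) = 0.
Proof.
move=> bA b0.
have h1 : \sum_(a in A) wt a * (a + b) ^+ (n * e) = 0.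
  transitivity (\sum_(u < e.+1) (b ^+ n) ^+ u *
      \sum_(a in A) wt a * (block_value u a * a ^+ 0)).
    under [RHS]eq_bigr do rewrite mulr_sumr.
    rewrite exchange_big; apply: eq_bigr => a _ /=.
    rewrite exprD_pcharnat // exprDn mulr_sumr; apply: eq_bigr => u _.
    rewrite /block_value exprM -[_ *+ 'C(e, u)]mulr_natr expr0; ring.
  rewrite big1 // => u _; rewrite block_moments; last by lia.
  by rewrite ltn_eqF ?mulr0 //; lia.
have h2 : \sum_(a in A) wt a * ((a - b) * (a + b) ^+ (n * e - 1)) = 0.
  pose Q : {poly F} := ('X - b%:P) ^+ 1 * ('X + b%:P) ^+ (e - 1).
  have sQ : (size Q <= e.+1)%N.
    apply: leq_trans (size_polyMleq _ _) _.
    by rewrite size_exp_XsubC size_exp_XaddC; lia.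
  transitivity (\sum_(a in A) wt a * Q.[a]).
    apply: eq_bigr => a aA; congr (_ * _); rewrite exponentE.
    rewrite hornerM !horner_exp hornerXsubC hornerD hornerX hornerC expr1.
    have [->|ab] := eqVneq a b; first by rewrite subrr !mul0r.
    by rewrite shift //; lia.
  rewrite sum_weight; last by lia.
  by rewrite nth_default //; apply: leq_trans sQ _; lia.
have : (2%:R * b) * \sum_(a in A) wt a * (a + b) ^+ (n * e - 1) = 0.
  transitivity (\sum_(a in A) wt a * (a + b) ^+ (n * e) -
      \sum_(a in A) wt a * ((a - b) * (a + b) ^+ (n * e - 1))).
    rewrite -sumrB mulr_sumr; apply: eq_bigr => a _.
    have -> : (a + b) ^+ (n * e) = (a + b) * (a + b) ^+ (n * e - 1).
      by rewrite -exprS; congr (_ ^+ _); nia.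
    ring.
  by rewrite h1 h2 subrr.
by move/eqP; rewrite !mulf_eq0 (negbTE two_neq0F) (negbTE b0) => /eqP.
Qed.

(** The weighted sums of (a + b)^(n e - 1) and of (a + b)^(e - 1) both vanish for b nonzero, and by
    [hA] their terms agree except at a = b. *)
Lemma double_fixed b : b \in A -> (b + b) ^+ m.+1 = b + b.
Proof.
move=> bA; have [->|b0] := eqVneq b 0; first by rewrite addr0 exprS mul0r.
have bb0 : b + b != 0 by rewrite -mulr2n -mulr_natl mulf_neq0.
have h1 := sum_poly0_root bA b0.
have h2 : \sum_(a in A) wt a * (a + b) ^+ (e - 1) = 0.
  transitivity (\sum_(a in A) wt a * (('X + b%:P) ^+ (e - 1)).[a]).
    by apply: eq_bigr => a _; rewrite !hornerE.
  rewrite sum_weight ?size_exp_XaddC; last by lia.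
  by rewrite nth_default // size_exp_XaddC; lia.
have : \sum_(a in A) wt a * (a + b) ^+ (n * e - 1)
    - \sum_(a in A) wt a * (a + b) ^+ (e - 1) = 0 by rewrite h1 h2 subrr.
rewrite -sumrB (bigD1 b) //= big1 ?addr0.
  move/eqP; rewrite -mulrBr mulf_eq0 (negbTE (lagrange_weight_neq0 _ _)) /= exponentE exprD.
  rewrite -{2}[_ ^+ (e - 1)]mul1r -mulrBl mulf_eq0 expf_eq0 (negbTE bb0) andbF.
  by rewrite orbF subr_eq0 => /eqP h; rewrite exprS h mulr1.
move=> a /andP[aA ab]; rewrite exponentE shift ?subrr //; lia.
Qed.

(** 2 lies in the prime field, so 2^(n-1) = 1; as n - 1 divides m, the factor 2 cancels from
    [double_fixed]. *)
Lemma elt_fixed b : b \in A -> b ^+ m.+1 = b.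
Proof.
move=> /double_fixed; rewrite -mulr2n -mulr_natl exprMn.
have h : 2%:R ^+ n.-1 = 1 :> F.
  apply: (mulfI two_neq0F); rewrite -exprS prednK; last by lia.
  by rewrite (natrD _ 1 1) exprDn_pchar // expr1n mulr1.
by rewrite [2%:R ^+ _]exprS mulnC exprM h expr1n mulr1 => /(mulfI two_neq0F).
Qed.

(** With the diagonal sums fixed, [dvdp_sum_poly] applies with M = 0 and gives zeros of order e - 1
    on [A], which exhaust the degree bound n (e - 1). *)
Lemma sum_poly0_dvd : exists c : F,
  sum_poly A 0 (n * e - 1) = c *: set_poly A ^+ (e - 1).
Proof.
have : set_poly A ^+ (e - 1) %| sum_poly A 0 (n * e - 1).
  rewrite {1}set_poly_enum; apply: dvdp_prod_exp_XsubC (enum_uniq _) _ => b.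
  rewrite mem_enum => bA; rewrite exponentE.
  have := @dvdp_sum_poly F A m (e - 1) 0 (e - 1) b bA (leqnn _) ltac:(lia).
  rewrite ltn_eqF ?subr0; last by lia.
  by apply=> [a aA ab|]; [apply: hA | right; apply: double_fixed].
case/dvdpP => q Pq; suff : (size q <= 1)%N.
  by move/size1_polyC => eq; exists q`_0; rewrite Pq eq mul_polyC coefC.
have := size_sum_poly A 0 (n * e - 1); rewrite Pq.
have [->|q0] := eqVneq q 0; first by rewrite size_poly0.
have g0 : set_poly A != 0 by rewrite monic_neq0 ?monic_set_poly.
rewrite size_mul ?expf_neq0 //.
have := size_exp (set_poly A) (e - 1); rewrite size_set_poly /=.
have : (0 < size (set_poly A ^+ (e - 1)))%N by rewrite size_poly_gt0 expf_neq0.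
case: (size (set_poly A ^+ (e - 1))) => //= k _ ->.
have -> : (n * e = n * (e - 1) + n)%N by rewrite -mulnSr subn1 prednK //; lia.
move: (n * (e - 1))%N => t.
have -> : (0 + (t + n - 1) - n.-1 = t)%N by lia.
by rewrite addnS /= -[t.+1]add1n leq_add2r.
Qed.

Local Notation psi := (phi \Po (- 'X)).

Lemma comp_set_polyNX : set_poly A \Po (- 'X) = - ('X^n + psi).
Proof.
rewrite set_polyE comp_polyB rmorphXn /= comp_polyX opprD exprNn.
by rewrite -signr_odd oA expr1 mulN1r.
Qed.

(** Y(x, T) of the overview. As n is odd, the Lagrange polynomial of a at -x, times x + a, is c_a
    h(x); so T = x^n gives h P. *)
Definition twisted_poly : {poly {poly F}} := \sum_(a in A)
  (lagrange_poly A a \Po (- 'X))%:P * ('X + (a ^+ n)%:P%:P) ^+ e.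
Local Notation Y := twisted_poly.

Lemma coef_twisted_poly u :
  Y`_u = interpolant A (block_value u) \Po (- 'X).
Proof.
rewrite coef_sum raddf_sum; apply: eq_bigr => a _ /=.
rewrite coefCM coef_XaddCn [RHS]comp_polyZ -[RHS]mul_polyC mulrC; congr (_ * _).
by rewrite polyCM polyCMn -polyC_exp -exprM.
Qed.

(** On [A], a^(n e) = a^(m+1) a^(e-1) = a^e by [elt_fixed], and X^e is its own interpolant because e
    < n. *)
Lemma coef0_twisted_poly : Y`_0 = (- 'X) ^+ e.
Proof.
rewrite coef_twisted_poly (_ : interpolant _ _ = 'X^e) ?rmorphXn /= ?comp_polyX //.
rewrite -[RHS](@interpolant_horner F A) ?size_polyXn; last by lia.
apply: eq_bigr => a aA; congr (_ *: _); rewrite hornerXn /block_value.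
rewrite subn0 bin0 mulr1 (_ : n * e = m.+1 + e.-1)%N; last by nia.
by rewrite exprD elt_fixed // -exprS prednK //; lia.
Qed.

Lemma horner_twisted_poly : Y.['X^n] = ('X^n + psi) * sum_poly A 0 (n * e - 1).
Proof.
rewrite horner_sum mulr_sumr; apply: eq_bigr => a aA.
rewrite hornerM hornerC horner_exp hornerD hornerX hornerC expr0 mul1r.
rewrite polyC_exp -exprD_pcharnat_poly // -scalerAr scalerAl.
have -> : ('X + a%:P) ^+ (n * e) = ('X + a%:P) * ('X + a%:P) ^+ (n * e - 1).
  by rewrite -exprS; congr (_ ^+ _); nia.
rewrite mulrA; congr (_ * _).
rewrite -[_ + psi]opprK -comp_set_polyNX (set_poly_split aA) comp_polyM.
rewrite comp_polyB comp_polyX comp_polyC /lagrange_poly comp_polyZ.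
by rewrite -scalerAl; congr (_ *: _); ring.
Qed.

(** Otherwise g' = n X^(n-1) - phi' would vanish, although g has simple roots. *)
Lemma deriv_frob_poly_neq0 : phi^`() != 0.
Proof.
have /card_gt0P[a aA] : (0 < n)%N by lia.
have := deriv_set_poly_neq0 aA; apply: contraNneq => d0.
by rewrite set_polyE derivB d0 subr0 derivXn -scaler_nat natr_pcharnat // scale0r horner0.
Qed.

(* With x^n replaced by an independent variable T, both sides have degree less
   than n in x, so the logarithmic derivative of h g^(e-1) survives as an
   identity in K[x][T]; it makes T + phi(-x) a factor of Y. *)
Lemma horner_twisted_poly_eq0 : Y.[- psi] = 0.
Proof.
have n0 := natr_pcharnat pA n_gt1.
have [c Pc] := sum_poly0_dvd.
have YX : Y.['X^n] = c *: (('X^n + psi) * ('X^n - phi) ^+ (e - 1)).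
  by rewrite horner_twisted_poly Pc set_polyE -scalerAr.
pose ht : {poly {poly F}} := 'X + psi%:P.
pose gt : {poly {poly F}} := 'X - phi%:P.
pose DY := map_poly (@deriv F) Y.
have B0 : DY * (ht * gt)
    - Y * (psi^`()%:P * gt - (e - 1)%:R *: (phi^`()%:P * ht)) = 0.
  have sY : coefs_size_le e.+1 Y.
    by move=> u; rewrite coef_twisted_poly size_comp_polyNX size_block_interpolant.
  have sderiv (p : {poly F}) : (size p^`() <= (size p).-1)%N by apply: size_poly.
  have sDY : coefs_size_le e DY.
    move=> u; rewrite coef_map_id0 ?deriv0 //; apply: leq_trans (sderiv _) _.
    by rewrite -subn1 leq_subLR add1n; apply: sY.
  have sphi := size_frob_poly.
  have spsi : (size psi <= e)%N by rewrite size_comp_polyNX.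
  have sX : coefs_size_le e ('X : {poly {poly F}}) by apply: coefs_size_leX; lia.
  have sht : coefs_size_le e ht by apply: coefs_size_leD sX (coefs_size_leC spsi).
  have sgt : coefs_size_le e gt.
    by apply: coefs_size_leD sX (coefs_size_leN (coefs_size_leC sphi)).
  have sphi' : (size phi^`() <= e.-1)%N.
    by rewrite (leq_trans (sderiv _)) // -!subn1 leq_sub2r.
  have spsi' : (size psi^`() <= e.-1)%N.
    by rewrite (leq_trans (sderiv _)) // -!subn1 leq_sub2r.
  have s1 := coefs_size_leM sDY (coefs_size_leM sht sgt).
  have s2 := coefs_size_leM (coefs_size_leC spsi') sgt.
  have s3 := coefs_size_leM (coefs_size_leC sphi') sht.
  (* In x, both terms have size at most 3 e - 2, hence at most n by [e3]. *)
  apply: (@horner_Xn_eq0 _ n).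
    apply: coefs_size_leD; first by apply: coefs_size_leW s1; lia.
    apply: coefs_size_leN; apply: (@coefs_size_leW _ (e.+1 + (e.-1 + e).-1).-1).
      lia.
    apply: coefs_size_leM sY _; apply: coefs_size_leD s2 (coefs_size_leN _).
    move=> u; rewrite coefZ mulr_natl; apply: leq_trans (s3 u).
    by rewrite -scaler_nat size_scale_leq.
  rewrite !(hornerM, hornerN, hornerZ, hornerC, hornerD, hornerX).
  rewrite -deriv_horner_Xn // YX -!mul_polyC derivM derivC mul0r add0r.
  rewrite derivM deriv_exp derivD derivB derivXn -scaler_nat n0 scale0r add0r sub0r.
  case: (e) e2 => [|[|f]] // _; rewrite subn1 /= -[_ *+ f.+1]mulr_natr exprS.
  ring.
have psi'0 : psi^`() != 0.
  rewrite deriv_comp derivN derivX mulrN1 oppr_eq0 comp_poly_eq0.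
    exact: deriv_frob_poly_neq0.
  by rewrite size_polyN size_polyX.
(* If phi is odd, [ht] and [gt] coincide and T = -psi only yields 0 = 0. Cancelling one factor first
   leaves the multiplicity e, nonzero in [F]. *)
have [eq_psi|ne_psi] := eqVneq psi (- phi).
  have gt0 : gt != 0.
    by rewrite -size_poly_gt0 size_XsubC.
  have ehg : ht = gt by rewrite /ht /gt eq_psi polyCN.
  have : gt * (DY * gt - Y * (e%:R *: psi^`()%:P)) = 0.
    rewrite -[RHS]B0 ehg eq_psi derivN -!mul_polyC.
    have -> : e%:R = (e - 1)%:R + 1 :> {poly F}.
      by rewrite natr1 subn1 prednK //; lia.
    rewrite !polyCD !polyCN polyC1; ring.
  move/eqP; rewrite mulf_eq0 (negbTE gt0) /= => /eqP.
  move/(congr1 (horner^~ (- psi))).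
  rewrite /= !(hornerM, hornerN, hornerZ, hornerC, hornerD, hornerX) ?horner0.
  rewrite eq_psi opprK subrr mulr0 sub0r -eq_psi => /eqP.
  rewrite oppr_eq0 !mulf_eq0 (negbTE psi'0) orbF => /orP[/eqP|] //.
  by rewrite -polyC1 -polyCMn polyC_eq0 (negbTE e_neq0).
(* Here T = -psi annihilates [ht] but not [gt]. *)
move/(congr1 (horner^~ (- psi))): B0.
rewrite /= !(hornerM, hornerN, hornerZ, hornerC, hornerD, hornerX) ?horner0.
rewrite addNr mul0r !mulr0 subr0 sub0r => /eqP.
rewrite oppr_eq0 !mulf_eq0 (negbTE psi'0) /= => /orP[/eqP //|].
by rewrite -opprD oppr_eq0 addr_eq0 (negbTE ne_psi).
Qed.

Lemma frob_linear : exists c : F, forall a, a \in A -> a ^+ n = c * a.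
Proof.
have := dvdp_coef0 horner_twisted_poly_eq0.
have exprNX k : (- 'X) ^+ k = (-1) ^+ k *: 'X^k :> {poly F}.
  by rewrite -scaleN1r exprZn.
rewrite dvdpNl coef0_twisted_poly exprNX dvdpZr ?signr_eq0 // -['X]subr0.
case/dvdp_exp_XsubCP=> k _.
rewrite subr0 => /eqpf_eq[c c0 eq_psi].
have eq_phi : phi = (c * (-1) ^+ k) *: 'X^k.
  rewrite -[phi]comp_polyNXK eq_psi comp_polyZ rmorphXn /= comp_polyX exprNX.
  by rewrite scalerA.
(* k = 0 would make phi' vanish, and k >= 2 would make 0 a multiple root of g. *)
have k1 : k = 1.
  have := deriv_frob_poly_neq0; rewrite eq_phi derivZ derivXn.
  case: k {eq_psi} eq_phi => [|[|k]] // eq_phi; first by rewrite mulr0n scaler0 eqxx.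
  have A0 : 0 \in A.
    rewrite -root_set_poly rootE set_polyE eq_phi hornerD hornerN hornerZ !hornerXn.
    by rewrite !expr0n gtn_eqF ?(ltnW n_gt1) //= mulr0 subr0.
  have := deriv_set_poly_neq0 A0; rewrite set_polyE eq_phi derivB derivZ !derivXn.
  rewrite -scaler_nat natr_pcharnat // scale0r sub0r.
  by rewrite hornerN hornerZ hornerMn hornerXn expr0n /= mul0rn mulr0 oppr0 eqxx.
exists (c * (-1) ^+ k) => a aA.
rewrite -[LHS](horner_interpolant (fun a => a ^+ n) aA) -/phi.
by rewrite eq_phi k1 !hornerE.
Qed.

End DvdSucc.

(** * Root counts in finite fields and reduction to a divisor of n + 1 or n - 1 *)

Lemma pcharnat_card (F : finFieldType) : [pchar F].-nat #|F|.
Proof.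
have [p pr_p pF] := finPcharP F.
have := abelem_pgroup (fin_ring_pchar_abelem pF).
rewrite /pgroup cardsT => /sub_in_pnat; apply=> x _.
by rewrite inE => /eqP ->.
Qed.

Lemma card_roots_le (F : finFieldType) (B : {set F}) (n : nat) (c : F) :
  (1 < n)%N -> (forall a, a \in B -> a ^+ n = c * a) -> (#|B| <= n)%N.
Proof.
move=> n1 hB; pose p : {poly F} := 'X^n - c *: 'X.
have sp : size p = n.+1.
  rewrite size_polyDl ?size_polyXn // size_polyN.
  by apply: leq_ltn_trans (size_scale_leq _ _) _; rewrite size_polyX; lia.
have p0 : p != 0 by rewrite -size_poly_gt0 sp.
have := max_poly_roots p0 _ (enum_uniq B); rewrite -cardE sp ltnS; apply.
apply/allP => a; rewrite mem_enum => /hB h.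
by rewrite rootE /p hornerD hornerN hornerZ hornerXn hornerX h subrr.
Qed.

Lemma card_exp1_le (F : finFieldType) (B : {set F}) (n : nat) :
  (0 < n)%N -> (forall a, a \in B -> a ^+ n = 1) -> (#|B| <= n)%N.
Proof.
move=> n0 hB; pose p : {poly F} := 'X^n - 1.
have sp : size p = n.+1 by rewrite size_XnsubC.
have p0 : p != 0 by rewrite -size_poly_gt0 sp.
have := max_poly_roots p0 _ (enum_uniq B); rewrite -cardE sp ltnS; apply.
apply/allP => a; rewrite mem_enum => /hB h.
by rewrite rootE /p !hornerE h subrr.
Qed.

Lemma expf_card_pred (F : finFieldType) (x : F) : x != 0 -> x ^+ #|F|.-1 = 1.
Proof.
move=> x0; apply: (mulfI x0); rewrite mulr1 -exprS prednK ?expf_card //.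
by apply/card_gt0P; exists x.
Qed.

(** If both were at most 2, then d, which divides their product, would be 4; but 4 divides n + 1 or
    n - 1 for n odd. *)
Lemma gcdn_sqr_pred_ge3 (d n : nat) :
  (3 <= d)%N -> odd n -> (d %| n ^ 2 - 1)%N ->
  (3 <= gcdn d n.+1)%N \/ (3 <= gcdn d n.-1)%N.
Proof.
move=> d3 on dn; have n0 : (0 < n)%N by case: (n) on.
have [|g1] := leqP 3 (gcdn d n.+1); [by left | right].
rewrite leqNgt; apply/negP => g2.
have : (d %| gcdn d n.+1 * gcdn d n.-1)%N.
  rewrite muln_gcdr dvdn_gcd dvdn_mull //= mulnC muln_gcdr dvdn_gcd dvdn_mull //=.
  by rewrite (_ : n.-1 * n.+1 = n ^ 2 - 1)%N //; nia.
have : (0 < gcdn d n.+1)%N by rewrite gcdn_gt0; lia.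
have : (0 < gcdn d n.-1)%N by rewrite gcdn_gt0; lia.
move=> g2_gt0 g1_gt0 /[dup] dvd /dvdn_leq le.
have {}le : (d <= gcdn d n.+1 * gcdn d n.-1)%N by apply: le; rewrite muln_gt0 g1_gt0.
have e1 : gcdn d n.+1 = 2 by nia.
have e2 : gcdn d n.-1 = 2 by nia.
have d4 : d = 4.
  move: dvd le; rewrite e1 e2 => dvd le.
  by case: d d3 dvd le {dn g1 g2 g1_gt0 g2_gt0 e1 e2} => [|[|[|[|[|]]]]].
have : (4 %| n.+1)%N || (4 %| n.-1)%N by move: on; lia.
by move: e1 e2; rewrite d4 => e1 e2 /orP[] /gcdn_idPl; rewrite ?e1 ?e2.
Qed.

Lemma expr_gcdn_eq1 (R : comNzRingType) (x : R) (a b : nat) :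
  (0 < a)%N -> x ^+ a = 1 -> x ^+ b = 1 -> x ^+ gcdn a b = 1.
Proof.
move=> a0 xa xb; have [k _ /dvdnP[t ht]] := Bezoutl b a0.
transitivity (x ^+ gcdn a b * (x ^+ b) ^+ k); first by rewrite xb expr1n mulr1.
by rewrite -exprM mulnC -exprD ht mulnC exprM xa expr1n.
Qed.

Lemma restricted_sums_fixed_powers (F : finFieldType) (A : {set F}) (d m : nat) :
  restricted_sumset A \subset powers F d :|: [set 0] ->
  (#|F|.-1 %| d * m)%N -> restricted_sums_fixed A m.
Proof.
move=> /subsetP hA /dvdnP[t dm] a b aA bA ab.
have := hA (a + b); rewrite !inE => H.
have /H/orP[] : a + b \in restricted_sumset A.
  by apply/imset2P; exists a b; rewrite ?inE ?bA.
  case/imsetP => y; rewrite inE => y0 ->.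
  by rewrite exprS -exprM dm mulnC exprM expf_card_pred // expr1n mulr1.
by move/eqP ->; rewrite exprS mul0r.
Qed.

(** 2 a = (a + b) + (a + c) - (b + c), and x -> x^n is additive. *)
Lemma three_sums_fixed (F : finFieldType) (A : {set F}) (n : nat) :
  [pchar F].-nat n -> 2%:R != 0 :> F -> (2 < #|A|)%N ->
  (forall a b, a \in A -> b \in A -> a != b -> (a + b) ^+ n = a + b) ->
  forall a, a \in A -> a ^+ n = a.
Proof.
move=> pn z2 A2 h a aA.
have : (1 < #|A :\ a|)%N by rewrite (cardsD1 a) aA in A2.
case/card_gt1P => b [c []]; rewrite !inE => /andP[ba bA] /andP[ca cA] bc.
have e1 := h a b aA bA ltac:(by rewrite eq_sym).
have e2 := h a c aA cA ltac:(by rewrite eq_sym).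
have e3 := h b c bA cA bc.
move: e1 e2 e3; rewrite !exprDn_pchar // => e1 e2 e3.
apply: (mulfI z2).
transitivity ((a ^+ n + b ^+ n) + (a ^+ n + c ^+ n) - (b ^+ n + c ^+ n)).
  by ring.
by rewrite e1 e2 e3; ring.
Qed.

Lemma frob_linear_of_restricted_sumset (F : finFieldType) (A : {set F}) (d : nat) :
  odd #|A| -> (2 < #|A|)%N -> #|F| = (#|A| ^ 2)%N ->
  (3 <= d)%N -> (d %| #|A| ^ 2 - 1)%N ->
  restricted_sumset A \subset powers F d :|: [set 0] ->
  exists c : F, forall a, a \in A -> a ^+ #|A| = c * a.
Proof.
set n := #|A| => oA n2 cF d3 dn hA.
have pA : [pchar F].-nat n.
  by apply: pnat_dvd (pcharnat_card F); rewrite cF dvdn_mulr.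
have nE : (n ^ 2 - 1 = n.+1 * n.-1)%N by nia.
case: (gcdn_sqr_pred_ge3 d3 oA dn) => g3; last first.
  have /dvdnP[k ek] := dvdn_gcdr d n.-1.
  have /dvdnP[t et] := dvdn_gcdl d n.-1.
  case: (@dvd_pred_no_restricted_sums F A (gcdn d n.-1) k); rewrite -/n //.
  - by case: (k) ek => [|//]; lia.
  - lia.
  apply: (restricted_sums_fixed_powers hA); rewrite cF -subn1 nE.
  apply/dvdnP; exists t; move: et ek; move: (gcdn d n.-1) => g -> ->.
  by rewrite -!mulnA; congr (_ * _)%N; lia.
have /dvdnP[e ee] := dvdn_gcdr d n.+1.
have /dvdnP[t et] := dvdn_gcdl d n.+1.
have hm : restricted_sums_fixed A (e * n.-1).
  apply: (restricted_sums_fixed_powers hA); rewrite cF -subn1 nE.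
  apply/dvdnP; exists t; move: et ee; move: (gcdn d n.+1) => g -> ->.
  by rewrite -!mulnA; congr (_ * _)%N; lia.
have [e1|le] := leqP 2 e.
  apply: (@frob_linear F A (gcdn d n.+1) e); rewrite -/n //; by rewrite mulnC.
(* Then m = n - 1, so x -> x^n fixes the restricted sums and c = 1 works. *)
have e1 : e = 1 by lia.
exists 1 => a aA; rewrite mul1r.
apply: (@three_sums_fixed F A) => //; first exact: two_neq0 pA (ltnW n2) oA.
move=> x y xA yA xy; have := hm x y xA yA xy.
by rewrite e1 mul1n prednK //; lia.
Qed.

Theorem theorem1p7 (F : finFieldType) (d q r : nat)
  (hd : (3 <= d)%N) (hF : #|F| = q) (hq1 : q = 1 %[mod d])
  (hodd : odd q) (hsq : q = (r ^ 2)%N)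
  (A : {set F})
  (hA : restricted_sumset A \subset powers F d :|: [set 0]) :
  (#|A| <= r)%N /\
  (#|A| = r <->
     (d %| r + 1)%N /\
     exists (K : {set F}) (alpha : F),
       [/\ is_subfield_of_card r K, alpha \in powers F d & A = dilate alpha K]).
Proof.
have or : odd r by move: hodd; rewrite hsq oddX.
have q1 : (1 < q)%N by rewrite -hF finNzRing_gt1.
have r2 : (2 < r)%N by case: r or hsq q1 {hF} => [|[|[|r]]] //; lia.
have dq : (d %| r ^ 2 - 1)%N by rewrite -hsq -eqn_mod_dvd ?hq1 //; lia.
(* The roots of X^r - c X number at most r and include 0 and all of [B]; having r elements, [B] must
   contain 0. *)
have key (B : {set F}) : #|B| = r -> B \subset A ->
    exists2 c : F, (forall a, a \in B -> a ^+ r = c * a) & 0 \in B.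
  move=> cB sBA.
  have hB : restricted_sumset B \subset powers F d :|: [set 0].
    apply: subset_trans hA; apply/subsetP => x /imset2P[a b aB].
    rewrite inE => /andP[bB ab] ->; apply/imset2P; exists a b => //.
      exact: (subsetP sBA).
    by rewrite inE (subsetP sBA _ bB).
  have := @frob_linear_of_restricted_sumset F B d.
  rewrite cB => /(_ or r2 ltac:(lia) hd dq hB)[c hc]; exists c => //.
  have := @card_roots_le F (0 |: B) r c ltac:(lia).
  case: (boolP (0 \in B)) => // nB; rewrite cardsU1 nB cB ltnn => H.
  suff: false by []. apply: H => a; rewrite !inE => /orP[/eqP ->|/hc //].
  by rewrite expr0n mulr0 gtn_eqF //; lia.
have leA : (#|A| <= r)%N.
  rewrite leqNgt; apply/negP => ltA.
  (* Discarding 0 still leaves r elements, contrary to [key]. *)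
  have : (r <= #|A :\ 0%R|)%N.
    by move: ltA; rewrite (cardsD1 0 A); case: (0 \in A) => //= /ltnW.
  case/card_geqP => s [us ss sub].
  have [||c _] := key [set x in s].
  - by rewrite cardsE (card_uniqP us).
  - by apply/subsetP => x; rewrite inE => /sub; rewrite !inE => /andP[].
  by rewrite inE => /sub; rewrite !inE eqxx.
split=> //; split; last first.
  case=> _ [K [al [[_ cK] /imsetP[x]]]]; rewrite inE => x0 ale ->.
  rewrite card_imset //; apply: mulfI; rewrite ale expf_neq0 //.
move=> cA; have [c hc A0] := key A cA (subxx _).
have /card_gt0P[al] : (0 < #|A :\ 0%R|)%N.
  by move: r2; rewrite -cA (cardsD1 0 A) A0 add1n ltnS => /ltnW.
rewrite !inE => /andP[al0 alA].
(* As 0 is in [A], a nonzero x in [A] is the restricted sum x + 0. *)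
have in_powers x : x \in A -> x != 0 -> x \in powers F d.
  move=> xA x0; have /(subsetP hA) : x \in restricted_sumset A.
    by apply/imset2P; exists x 0; rewrite ?addr0 // inE A0.
  by rewrite !inE (negbTE x0) orbF.
pose K := [set x : F | x ^+ r == x].
have pr : [pchar F].-nat r.
  by apply: pnat_dvd (pcharnat_card F); rewrite hF hsq dvdn_mulr.
have cal : al ^+ r = c * al by apply: hc.
have c0 : c != 0.
  by apply: contraNneq al0 => c0; move/eqP: cal; rewrite c0 mul0r expf_eq0 => /andP[].
have cK : (#|K| <= r)%N.
  apply: (@card_roots_le _ _ _ 1); first by lia.
  by move=> a; rewrite inE mul1r => /eqP.
(* x -> x^r multiplies both a and [al] by c, so it fixes a / al. *)
have sA : A \subset dilate al K.
  apply/subsetP => a aA; apply/imsetP; exists (al^-1 * a); last by rewrite mulVKf.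
  by rewrite inE exprMn (hc _ aA) exprVn cal invfM mulrACA mulVf // mul1r.
have cD : #|dilate al K| = #|K| by apply: card_imset; apply: mulfI.
have eA : A = dilate al K by apply/eqP; rewrite eqEcard sA cD cA.
have cKr : #|K| = r by rewrite -cD -eA.
split.
  (* For x nonzero in [K], both [al] and al x are d-th powers, so x^m = 1; also x^(r-1) = 1.
     Counting the r - 1 such x gives gcd(r - 1, m) = r - 1, and d m = (r + 1) (r - 1) then shows
     that d divides r + 1. *)
  pose m := ((r ^ 2 - 1) %/ d)%N.
  have dm : (d * m = r.+1 * r.-1)%N by rewrite mulnC divnK //; nia.
  have powers_exp x : x \in powers F d -> x ^+ m = 1.
    case/imsetP => y; rewrite inE => y0 ->; rewrite -exprM dm mulnC.
    by rewrite (_ : r.-1 * r.+1 = #|F|.-1)%N ?expf_card_pred //; nia.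
  have K1 x : x \in K :\ 0 -> x ^+ gcdn r.-1 m = 1.
    rewrite !inE => /andP[x0 /eqP xr]; apply: expr_gcdn_eq1; first by lia.
      by apply: (mulfI x0); rewrite mulr1 -exprS prednK //; lia.
    have : al * x \in A by rewrite eA; apply: imset_f; rewrite inE xr.
    move/in_powers; rewrite mulf_neq0 // => /(_ isT)/powers_exp.
    by rewrite exprMn powers_exp ?mul1r // in_powers.
  have g0 : (0 < gcdn r.-1 m)%N by rewrite gcdn_gt0; lia.
  have := card_exp1_le g0 K1.
  have -> : #|K :\ 0| = r.-1.
    by rewrite -cKr (cardsD1 0 K) inE expr0n gtn_eqF ?eqxx //; lia.
  move=> le; have /gcdn_idPl/dvdnP[e em] : gcdn r.-1 m = r.-1.
    by apply/eqP; rewrite eqn_leq le dvdn_leq ?dvdn_gcdl //; lia.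
  apply/dvdnP; exists e; have r1 : (0 < r.-1)%N by lia.
  by apply/eqP; rewrite -(eqn_pmul2r r1) addn1 -dm em; apply/eqP; lia.
exists K, al; split => //; last exact: in_powers.
split=> //; split.
- by rewrite inE expr1n.
- move=> x y; rewrite !inE => /eqP hx /eqP hy.
  by rewrite exprDn_pchar // exprNn -signr_odd or expr1 mulN1r hx hy.
- move=> x y; rewrite !inE => /eqP hx /eqP hy.
  by rewrite exprMn exprVn hx hy.
Qed.
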